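(* Let a connected directed graph (without self-loops) with $n$ nodes and $m$ edges be given, with incidence matrix $A\in\mathbb{R}^{n\times m}$, together with an assignment of a weight $W_j\in\{-1,+1\}$ to each edge $j$ (a connected signed digraph), and let $W=\mathrm{diag}(W_1,\dots,W_m)$. Consider the dynamical system $$x'=-AWA^{\mathsf T}x,\qquad x\in\mathbb{R}^n.$$ Then the dimension of its equilibrium set is higher than one if and only if the numbers of positive and negative spanning trees of the digraph coincide.
   Context: The incidence matrix $A=(a_{ij})$ of a digraph has $a_{ij}=1$ if edge $j$ leaves node $i$, $a_{ij}=-1$ if edge $j$ enters node $i$, and $a_{ij}=0$ if edge $j$ is not incident with node $i$. Connectedness and spanning trees refer to the underlying undirected graph. A spanning tree is positive (resp. negative) if the product of the weights of its edges is $+1$ (resp. $-1$), equivalently if it contains an even (resp. odd) number of edges with negative weight. The equilibrium set is the linear space $\ker(AWA^{\mathsf T})$. *)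

(* Defs.v *)
From HB Require Import structures.
From mathcomp Require Import all_boot all_order all_algebra.
From mathcomp Require Import boolp reals.

Set Implicit Arguments.
Unset Strict Implicit.
Unset Printing Implicit Defensive.

Import Order.TTheory GRing.Theory Num.Theory.
Local Open Scope ring_scope.

(* Parallel and antiparallel edges are allowed. *)
Record digraph (n m : nat) := Digraph {
  tail : 'I_m -> 'I_n;
  head : 'I_m -> 'I_n;
  no_loop : forall j, tail j != head j }.

Section Graph.
Variables (n m : nat) (G : digraph n m).
Implicit Types (T : {set 'I_m}) (j : 'I_m) (u v : 'I_n).

Definition joins j u v : bool :=
  ((tail G j == u) && (head G j == v)) || ((tail G j == v) && (head G j == u)).

Definition adjacent T : rel 'I_n := fun u v => [exists j in T, joins j u v].

Definition connected_by T : Prop := forall u v, connect (adjacent T) u v.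

Definition connected : Prop := connected_by [set: 'I_m].

(* [:: (v_1, e_1); ...; (v_k, e_k)] encodes the closed walk
   v_1 -e_1- v_2 -e_2- ... v_k -e_k- v_1; uniqueness of the edges matters only
   for k = 2, where two parallel edges form a cycle but a single edge traversed
   back and forth does not. *)
Definition is_cycle T (c : seq ('I_n * 'I_m)) : Prop :=
  [/\ c <> [::],
      cycle (fun p q => joins p.2 p.1 q.1) c,
      uniq [seq p.1 | p <- c],
      uniq [seq p.2 | p <- c] &
      all (fun p => p.2 \in T) c].

Definition acyclic T : Prop := forall c, ~ is_cycle T c.

(* A spanning tree is identified with its set of edges; its node set is 'I_n. *)
Definition spanning_tree T : Prop := connected_by T /\ acyclic T.

End Graph.

Section SignedGraph.
Variables (R : realType) (n m : nat) (G : digraph n m) (w : 'I_m -> R).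

Definition incidence : 'M[R]_(n, m) :=
  \matrix_(i, j) (if tail G j == i then 1 else if head G j == i then -1 else 0).

Definition weight_mx : 'M[R]_m := diag_mx (\row_j w j).

(* The right-hand side of x' = - A W A^T x. *)
Definition vector_field (x : 'cV[R]_n) : 'cV[R]_n :=
  - (incidence *m weight_mx *m incidence^T) *m x.

HB.instance Definition _ :=
  GRing.Linear.copy vector_field
    (mulmx (- (incidence *m weight_mx *m incidence^T)) : 'cV[R]_n -> 'cV[R]_n).

Definition equilibrium_set : {vspace 'cV[R]_n} := lker (linfun vector_field).

Lemma mem_equilibrium_set x :
  (x \in equilibrium_set) = (vector_field x == 0).
Proof. by rewrite memv_ker lfunE. Qed.

Lemma mem_equilibrium_set_ker x :
  (x \in equilibrium_set) =
  (incidence *m weight_mx *m incidence^T *m x == 0).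
Proof. by rewrite mem_equilibrium_set /vector_field mulNmx oppr_eq0. Qed.

Definition tree_weight (T : {set 'I_m}) : R := \prod_(j in T) w j.

Definition positive_spanning_trees : {set {set 'I_m}} :=
  [set T | `[< spanning_tree G T /\ tree_weight T = 1 >]].

Definition negative_spanning_trees : {set {set 'I_m}} :=
  [set T | `[< spanning_tree G T /\ tree_weight T = -1 >]].

End SignedGraph.

(* Main.v *)
Require Import Defs.
From HB Require Import structures.
From mathcomp Require Import all_boot all_order all_algebra.
From mathcomp Require Import boolp reals.
From mathcomp Require Import perm.

(* [head] and [tail] are the ends of an edge, not the operations on sequences. *)
Import Defs.

(** Let A be the incidence matrix on the nodes 0, ..., n, let B be A without
the row of node 0, and let L = B W B^T be the grounded Laplacian. The columns
of A sum to zero, so A = E B for the matrix E with columns e_(k+1) - e_0, and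
A W A^T = E L E^T. As E is injective and the kernel of E^T consists of the
constant vectors, the equilibrium set is the preimage of ker L under the
surjection E^T: its dimension exceeds one exactly when det L = 0
([dim_equilibrium_set]).

The weighted matrix-tree theorem ([weighted_matrix_tree]) says that det L is
the sum of the weights of the spanning trees. When all weights are 1 or -1,
this sum is the number of positive trees minus the number of negative ones,
which gives the equivalence.

The matrix-tree theorem rests on the Cauchy-Binet formula ([Cauchy_Binet]),
which expands det L over the sets T of n edges, with a coefficient equal to
the square of the determinant of the square submatrix B_T of the columns in T.
The three cases are read off linear relations:
- if T is connected, the walks from the nodes to node 0 are the columns of an
  integer right inverse of B_T, so det B_T is a unit of the integers and its
  square is 1;
- if T is disconnected, the indicator row of a component is orthogonal to every
  edge of T, so B_T is singular;
- if T contains a cycle, the signed sum of its edges vanishes, so B_T is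
  singular.
A spanning tree has exactly n edges for a similar reason: connectedness gives
B_T a right inverse, while acyclicity gives it a left inverse, whose rows are
the indicators of the two-part cuts made by deleting one edge
([card_spanning_tree]). The graph without nodes is treated apart: it has one
spanning tree, the empty one. *)

Set Implicit Arguments.
Unset Strict Implicit.
Unset Printing Implicit Defensive.

Import Order.TTheory GRing.Theory Num.Theory.
Local Open Scope ring_scope.

(** * The Cauchy-Binet formula *)

Section CauchyBinet.
Variable R : comNzRingType.

(** Multilinearity of the determinant in the rows of the product: row i of M N
is a combination of the rows of N, and f records which one is chosen. *)
Lemma det_mulmx_rowsub (p m : nat) (M : 'M[R]_(p, m)) (N : 'M[R]_(m, p)) :
  \det (M *m N) =
  \sum_(f : {ffun 'I_p -> 'I_m}) (\prod_i M i (f i)) * \det (rowsub f N).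
Proof.
transitivity (\sum_(s : 'S_p) \sum_(f : {ffun 'I_p -> 'I_m})
    (-1) ^+ s * \prod_i (M i (f i) * N (f i) (s i))).
  apply: eq_bigr => s _; rewrite -big_distrr /=; congr (_ * _).
  rewrite -(bigA_distr_bigA (fun i j => M i j * N j (s i))) /=.
  by apply: eq_bigr => i _; rewrite mxE.
rewrite exchange_big; apply: eq_bigr => f _ /=; rewrite big_distrr /=.
apply: eq_bigr => s _; rewrite big_split /= mulrCA; congr (_ * (_ * _)).
by apply: eq_bigr => i _; rewrite mxE.
Qed.

Lemma det_mulmx_injective (p m : nat) (M : 'M[R]_(p, m)) (N : 'M[R]_(m, p)) :
  \det (M *m N) =
  \sum_(f : {ffun 'I_p -> 'I_m} | injectiveb f)
    (\prod_i M i (f i)) * \det (rowsub f N).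
Proof.
rewrite det_mulmx_rowsub (bigID (fun f : {ffun 'I_p -> 'I_m} => injectiveb f)).
rewrite /= [X in _ + X]big1 ?addr0 // => f /injectivePn[i1 [i2 Di12 Ef12]].
by rewrite (determinant_alternate Di12) ?mulr0 // => j; rewrite !mxE Ef12.
Qed.

(** Masking stands for the restriction to the columns or rows in T: it keeps the
dimensions fixed, whereas a submatrix would depend on an enumeration of T. *)
Definition mask_mx (m : nat) (T : {set 'I_m}) : 'M[R]_m :=
  diag_mx (\row_j (j \in T)%:R).

(** The terms of the row expansion are grouped according to the image T of the
injection f. The expansion with the mask of T in place of w has the same terms
for that T, and no others: a set of p elements contains the image of an
injection from 'I_p only if it equals it. *)
Lemma Cauchy_Binet (p m : nat) (M : 'M[R]_(p, m)) (w : 'rV[R]_m)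
    (N : 'M[R]_(m, p)) :
  \det (M *m diag_mx w *m N) =
  \sum_(T : {set 'I_m} | #|T| == p)
    (\prod_(j in T) w 0 j) * \det (M *m mask_mx T *m N).
Proof.
rewrite det_mulmx_injective.
rewrite (partition_big (fun f : {ffun 'I_p -> 'I_m} => [set f i | i in 'I_p])
           (fun T => #|T| == p)) /=; last first.
  by move=> f /injectiveP f_inj; rewrite card_imset // card_ord.
apply: eq_bigr => T /eqP cardT; rewrite det_mulmx_injective big_distrr /=.
rewrite [RHS](bigID (fun f : {ffun 'I_p -> 'I_m} =>
                       [set f i | i in 'I_p] == T)) /=.
rewrite [X in _ = _ + X]big1 ?addr0 => [|f /andP[/injectiveP f_inj neT]].
  apply: eq_bigr => f /andP[/injectiveP f_inj /eqP defT].
  rewrite mulrA; congr (_ * _).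
  have ->: \prod_(j in T) w 0 j = \prod_i w 0 (f i).
    by rewrite -defT big_imset //=; exact: in2W.
  rewrite -big_split /=; apply: eq_bigr => i _.
  by rewrite !mul_mx_diag !mxE -defT imset_f // mulr1 mulrC.
have [i fiT]: exists i, f i \notin T.
  apply/existsP; apply: contraNT neT; rewrite negb_exists => /forallP fT.
  rewrite eqEcard card_imset // cardT card_ord leqnn andbT.
  by apply/subsetP=> _ /imsetP[i _ ->]; have:= fT i; rewrite negbK.
by rewrite (bigD1 i) //= mul_mx_diag !mxE (negPf fiT) mulr0 !mul0r mulr0.
Qed.

Lemma mulmx_sub_support (p q m k : nat) (g : 'I_k -> 'I_m)
    (M : 'M[R]_(p, m)) (N : 'M[R]_(m, q)) :
  injective g -> (forall i j, i \notin codom g -> N i j = 0) ->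
  colsub g M *m rowsub g N = M *m N.
Proof.
move=> g_inj N0; apply/matrixP=> i j; rewrite !mxE.
rewrite [RHS](bigID (mem (codom g))) /= [X in _ + X]big1 ?addr0; last first.
  by move=> l /N0 ->; rewrite mulr0.
have g_inj2: {in 'I_k &, injective g} by exact: in2W.
rewrite (eq_bigl (mem [set g l | l in 'I_k])); last first.
  by move=> l /=; apply/codomP/imsetP=> [[x]|[x _]]; exists x.
by rewrite big_imset //=; apply: eq_bigr => l _; rewrite !mxE.
Qed.

Lemma mulmx_mask (p q m k : nat) (g : 'I_k -> 'I_m)
    (M : 'M[R]_(p, m)) (N : 'M[R]_(m, q)) :
  injective g ->
  M *m mask_mx [set g l | l in 'I_k] *m N = colsub g M *m rowsub g N.
Proof.
move=> g_inj; rewrite -mulmxA -(mulmx_sub_support _ g_inj) => [|i j gi].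
  congr (_ *m _); apply/matrixP=> i j.
  by rewrite mul_diag_mx !mxE imset_f ?mul1r.
rewrite mul_diag_mx !mxE; case: imsetP => [[l _ Di]|]; last by rewrite mul0r.
by rewrite Di codom_f in gi.
Qed.

End CauchyBinet.

Lemma sum_mul_delta (R : pzRingType) (n : nat) (F : 'I_n -> R) k :
  \sum_i F i * (k == i)%:R = F k.
Proof.
rewrite (bigD1 k) //= eqxx mulr1 big1 ?addr0 // => i.
by rewrite eq_sym => /negPf->; rewrite mulr0.
Qed.

Lemma det_int (R : archiRealDomainType) (p : nat) (M : 'M[R]_p) :
  (forall i j, M i j \is a Num.int) -> \det M \is a Num.int.
Proof.
move=> ZM; apply: rpred_sum => s _; rewrite rpredM ?rpred_prod //.
by rewrite rpredX ?rpredN ?rpred1.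
Qed.

(** * Paths, cycles and cuts through the incidence matrix *)

Section Incidence.
Variables (R : realType) (n m : nat) (G : digraph n m).
Implicit Types (T : {set 'I_m}) (u v : 'I_n) (j : 'I_m).
Local Notation A := (incidence R G).

Lemma incidenceE i j :
  A i j = (tail G j == i)%:R - (head G j == i)%:R.
Proof.
rewrite mxE; case: eqP => [<-|_]; last by case: eqP; rewrite ?subr0 ?sub0r.
by rewrite eq_sym (negPf (no_loop _ _)) subr0.
Qed.

Lemma mul_row_incidence (x : 'rV[R]_n) j :
  (x *m A) 0 j = x 0 (tail G j) - x 0 (head G j).
Proof.
rewrite mxE; under eq_bigr => i _ do rewrite incidenceE mulrBr.
by rewrite sumrB !sum_mul_delta.
Qed.

Lemma incidence_edge j :
  A *m delta_mx j 0 =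
  delta_mx (tail G j) 0 - delta_mx (head G j) 0 :> 'cV[R]_n.
Proof.
apply/colP=> i; rewrite -colE mxE incidenceE !mxE !andbT.
by rewrite ![i == _]eq_sym.
Qed.

Lemma adjacent_sym T : symmetric (adjacent G T).
Proof. by move=> u v; apply: eq_existsb => j; rewrite /joins orbC. Qed.

Lemma connect_adjacent_sym T : connect_sym (adjacent G T).
Proof. exact/sym_connect_sym/adjacent_sym. Qed.

Lemma adjacent_edge T j : j \in T -> adjacent G T (tail G j) (head G j).
Proof. by move=> jT; apply/existsP; exists j; rewrite jT /joins !eqxx. Qed.

Definition component (T : {set 'I_m}) u : 'rV[R]_n :=
  \row_v (connect (adjacent G T) u v)%:R.

(** Both ends of an edge of T lie in the same component. *)
Lemma component_incidence T u j : j \in T -> (component T u *m A) 0 j = 0.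
Proof.
move=> jT; rewrite mul_row_incidence !mxE.
rewrite (same_connect1r (connect_adjacent_sym T) (adjacent_edge jT)).
exact: subrr.
Qed.

(** A pair (v, j) is the step that leaves v along the edge j; the sign compares
the direction of travel with that of the edge. *)
Definition step_sign (p : 'I_n * 'I_m) : R :=
  if tail G p.2 == p.1 then 1 else -1.

Lemma incidence_step p v : joins G p.2 p.1 v ->
  A *m (step_sign p *: delta_mx p.2 0) =
  delta_mx p.1 0 - delta_mx v 0 :> 'cV[R]_n.
Proof.
rewrite -scalemxAr incidence_edge /step_sign /joins.
case: eqP => [->|_] /=; last first.
  by case/andP=> /eqP-> /eqP->; rewrite scaleN1r opprB.
rewrite scale1r => /orP[/eqP->//|/andP[/eqP Dp /eqP hp]].
by rewrite hp Dp.
Qed.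

(** The boundaries of the steps telescope. In particular a closed walk has
boundary zero. *)
Lemma incidence_walk p s q :
  path (fun p q => joins G p.2 p.1 q.1) p (rcons s q) ->
  A *m (\sum_(r <- p :: s) step_sign r *: delta_mx r.2 0) =
  delta_mx p.1 0 - delta_mx q.1 0 :> 'cV[R]_n.
Proof.
elim: s p => [|r s IHs] p /= /andP[pr]; rewrite big_cons mulmxDr.
  by rewrite big_nil mulmx0 addr0 (incidence_step pr).
by move/IHs->; rewrite (incidence_step pr) subrKA.
Qed.

(** The signed sum of the edges of a cycle is nonzero because no edge of the
cycle is repeated: the coefficient of the first one is 1 or -1. *)
Lemma cycle_dependency T c : is_cycle G T c ->
  exists2 y : 'cV[R]_m, y != 0 &
    A *m y = 0 /\ forall j, j \notin T -> y j 0 = 0.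
Proof.
case: c => [|p s] [// _ walk _ /andP[p_s _] /andP[pT sT]].
exists (\sum_(r <- p :: s) step_sign r *: delta_mx r.2 0).
  apply/eqP=> /colP/(_ p.2)/eqP; rewrite big_cons !mxE !eqxx summxE big_seq big1.
    by rewrite addr0 mulr1 /step_sign; case: ifP; rewrite ?oppr_eq0 oner_eq0.
  move=> r rs; rewrite !mxE; case: eqP => [Dr|]; last by rewrite mulr0.
  by rewrite Dr map_f in p_s.
split=> [|j jT]; first by rewrite (incidence_walk walk) subrr.
rewrite summxE big_seq big1 // => r rs; rewrite !mxE; case: eqP => [Dr|].
  by have /allP/(_ r rs) := (introT andP (conj pT sT) : all _ (p :: s));
    rewrite -Dr (negPf jT).
by rewrite mulr0.
Qed.

Lemma connect_dependency (T : {set 'I_m}) u v : connect (adjacent G T) u v ->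
  exists y : 'cV[R]_m,
    [/\ A *m y = delta_mx u 0 - delta_mx v 0, forall j, y j 0 \is a Num.int &
        forall j, j \notin T -> y j 0 = 0].
Proof.
case/connectP=> s; elim: s u => [u _ ->|v' s IHs u].
  exists 0; split=> [|j|j _]; rewrite ?mulmx0 ?subrr ?mxE ?rpred0 //.
case/andP=> /existsP[j /andP[jT uv']] /IHs{}IHs /IHs[y [Ay Zy y0]].
exists (step_sign (u, j) *: delta_mx j 0 + y); split=> [|j'|j' j'T].
- by rewrite mulmxDr Ay (@incidence_step (u, j) v') // subrKA.
- rewrite !mxE rpredD // rpredM ?natr_int //.
  by rewrite /step_sign; case: ifP; rewrite ?rpredN rpred1.
- rewrite !mxE y0 // addr0; case: eqP => [Dj|]; last by rewrite mulr0.
  by rewrite Dj jT in j'T.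
Qed.

(** A path is given by its nodes only, so an edge must be chosen for each step.
An edge used later has both ends among the later nodes, so it differs from the
first one, which meets u: this is why the ends of the edges are recorded. The
last clause is stated with arbitrary surrounding steps p and q, for use with
the single step that closes the path into a cycle. *)
Lemma path_walk T u s :
  path (adjacent G T) u s -> uniq (u :: s) ->
  exists c : seq ('I_n * 'I_m),
  [/\ [seq p.1 | p <- c] = belast u s, uniq [seq p.2 | p <- c],
      all (fun p => p.2 \in T) c,
      (forall p, p \in c -> (tail G p.2 \in u :: s) && (head G p.2 \in u :: s)) &
      forall p q, joins G p.2 p.1 u -> q.1 = last u s ->
        path (fun p q => joins G p.2 p.1 q.1) p (rcons c q)].
Proof.
elim: s u => [|v s IHs] u /=.
  by move=> _ _; exists [::]; split=> // p q; rewrite /= andbT => pu ->.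
case/andP=> /existsP[j /andP[jT uv]] /IHs{}IHs /andP[us /IHs].
move=> [c [vc uc cT cs walk]].
exists ((u, j) :: c); rewrite /= vc uc jT cT andbT; split=> //.
- apply/mapP=> -[p pc Dj]; have /andP[] := cs p pc; rewrite -Dj.
  by case/orP: uv => /andP[/eqP-> /eqP->]; rewrite (negPf us).
- move=> p; rewrite inE => /predU1P[->|/cs/andP[tp hp]] /=.
    by case/orP: uv => /andP[/eqP-> /eqP->]; rewrite !inE !eqxx ?orbT.
  by rewrite in_cons tp in_cons hp !orbT.
- by move=> p q pu Dq; rewrite pu walk.
Qed.

(** A simple path joining the ends of j and avoiding j would form a cycle with
j. *)
Lemma acyclic_bridge T j : acyclic G T -> j \in T ->
  ~~ connect (adjacent G (T :\ j)) (tail G j) (head G j).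
Proof.
move=> acT jT; apply/negP=> /connectP[s0 ps0 ls0].
case/shortenP: ps0 ls0 => s ps us _ ls.
have [c [vc uc cT _ walk]] := path_walk ps us.
apply: (acT ((head G j, j) :: c)); split=> //.
- by rewrite /= walk // /joins !eqxx orbT.
- by rewrite /= vc ls -rcons_uniq -lastI.
- rewrite /= uc andbT; apply/mapP=> -[p pc Dj].
  by have /allP/(_ p pc) := cT; rewrite !inE -Dj eqxx.
- by rewrite /= jT; apply: sub_all cT => p; rewrite inE => /andP[].
Qed.

End Incidence.

(** * The incidence matrix without its first row *)

Section Reduced.
Variables (R : realType) (n m : nat) (G : digraph n.+1 m).
Implicit Types (T : {set 'I_m}) (w : 'I_m -> R).
Local Notation A := (incidence R G).

Definition reduced_incidence : 'M[R]_(n, m) := row' ord0 A.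
Local Notation B := reduced_incidence.

(** The columns are e_(k+1) - e_0, so that the product with [ground_mx] restores
the row of node 0 as minus the sum of the others. *)
Definition ground_mx : 'M[R]_(n.+1, n) :=
  \matrix_(i, k) ((lift ord0 k == i)%:R - (ord0 == i)%:R).
Local Notation E := ground_mx.

Lemma mul_row_ground (x : 'rV[R]_n.+1) k :
  (x *m E) 0 k = x 0 (lift ord0 k) - x 0 ord0.
Proof.
rewrite mxE; under eq_bigr => i _ do rewrite mxE mulrBr.
by rewrite sumrB !sum_mul_delta.
Qed.

Lemma ground_reduced : E *m B = A.
Proof.
have sumA j: \sum_i A i j = 0.
  transitivity (((const_mx 1 : 'rV[R]_n.+1) *m A) 0 j).
    by rewrite mxE; apply: eq_bigr => i _; rewrite [const_mx _ _ _]mxE mul1r.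
  by rewrite mul_row_incidence !mxE subrr.
apply/matrixP=> i j; rewrite mxE; case: (unliftP ord0 i) => [k|] ->.
  rewrite (bigD1 k) //= !mxE eqxx subr0 mul1r big1 ?addr0 // => l lk.
  by rewrite !mxE (inj_eq lift_inj) (negPf lk) subr0 mul0r.
have /eqP := sumA j; rewrite big_ord_recl addr_eq0 => /eqP->.
rewrite -sumrN; apply: eq_bigr => k _.
by rewrite [E _ _]mxE [B _ _]mxE eqxx sub0r mulN1r.
Qed.

(** Column k collects the signed edges of a walk from the node k + 1 to node 0,
whose boundary e_(k+1) - e_0 loses its second term with the row of node 0. *)
Lemma connected_right_inverse p (g : 'I_p -> 'I_m) :
  injective g -> connected_by G [set g k | k in 'I_p] ->
  exists2 P : 'M[R]_(p, n),
    (forall i j, P i j \is a Num.int) & colsub g B *m P = 1%:M.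
Proof.
move=> g_inj conT.
have [y Hy] := fin_all_exists (fun k : 'I_n =>
  connect_dependency R (conT (lift ord0 k) ord0)).
pose Y : 'M[R]_(m, n) := \matrix_(j, k) y k j 0.
exists (rowsub g Y) => [i j|]; first by rewrite !mxE; case: (Hy j) => _ ->.
rewrite (mulmx_sub_support _ g_inj) => [|j k gj]; last first.
  rewrite mxE; case: (Hy k) => _ _ -> //.
  by apply: contra gj => /imsetP[l _ ->]; exact: codom_f.
apply/matrixP=> i k; have [/colP/(_ (lift ord0 i)) Ay _ _] := Hy k.
rewrite !mxE in Ay *; rewrite andbT subr0 (inj_eq lift_inj) in Ay.
by rewrite -Ay; apply: eq_bigr => j _; rewrite !mxE.
Qed.

(** Row k comes from the component of the tail of edge k once this edge is
deleted. It is constant along the other edges, and separates the two ends of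
edge k, which is a bridge. Multiplication by [ground_mx] shifts an indicator to
vanish at node 0, which does not alter its differences along edges. *)
Lemma acyclic_left_inverse p (g : 'I_p -> 'I_m) :
  injective g -> acyclic G [set g k | k in 'I_p] ->
  exists Q : 'M[R]_(p, n), Q *m colsub g B = 1%:M.
Proof.
move=> g_inj acT; set T := [set g k | k in 'I_p] in acT.
pose x k := component R G (T :\ g k) (tail G (g k)).
pose X : 'M[R]_(p, n.+1) := \matrix_k x k.
exists (X *m E); rewrite -mulmxA !mulmx_colsub ground_reduced.
apply/matrixP=> k l; rewrite mxE [RHS]mxE.
have ->: (X *m A) k (g l) = (x k *m A) 0 (g l).
  by rewrite -[x k](rowK x) -row_mul [RHS]mxE.
have gT i: g i \in T by exact: imset_f.
have [<-|kl] := eqVneq k l; last first.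
  by rewrite component_incidence // !inE gT (inj_eq g_inj) eq_sym kl.
rewrite mul_row_incidence !mxE connect0.
by rewrite (negPf (acyclic_bridge acT (gT k))) subr0.
Qed.

Lemma set_enum T : exists2 g : 'I_#|T| -> 'I_m,
  injective g & T = [set g k | k in 'I_#|T|].
Proof.
exists enum_val; first exact: enum_val_inj.
apply/setP=> j; apply/idP/imsetP=> [jT|[k _ ->]]; last exact: enum_valP.
by exists (enum_rank_in jT j); rewrite // enum_rankK_in.
Qed.

Lemma card_spanning_tree T : spanning_tree G T -> #|T| = n.
Proof.
have [g g_inj DT] := set_enum T; rewrite [X in spanning_tree _ X]DT.
case=> /(connected_right_inverse g_inj)[P _ gP].
move=> /(acyclic_left_inverse g_inj)[Q Qg].
by apply/eqP; rewrite eqn_leq (mulmx1_min gP) (mulmx1_min Qg).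
Qed.

(** The determinants of the matrix and of its right inverse are integers with
product 1. Hence both have a square that is at least 1, and the product of
these squares is 1. *)
Lemma sqr_det_reduced_connected (g : 'I_n -> 'I_m) :
  injective g -> connected_by G [set g k | k in 'I_n] ->
  \det (colsub g B) ^+ 2 = 1.
Proof.
move=> g_inj /(connected_right_inverse g_inj)[P ZP gP].
have ZgB i j: colsub g B i j \is a Num.int.
  by rewrite !mxE; do 2?case: ifP => _; rewrite ?rpredN ?rpred1 ?rpred0.
have ddP: \det (colsub g B) * \det P = 1 by rewrite -det_mulmx gP det1.
have d0: \det (colsub g B) != 0.
  by apply: contra_eq_neq ddP => ->; rewrite mul0r eq_sym oner_neq0.
have dP0: \det P != 0.
  by apply: contra_eq_neq ddP => ->; rewrite mulr0 eq_sym oner_neq0.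
apply: le_anti; rewrite sqr_intr_ge1 ?det_int // andbT.
rewrite -(expr1n R 2) -ddP exprMn ler_peMr ?sqr_ge0 //.
by rewrite sqr_intr_ge1 ?det_int.
Qed.

(** Let v be unreachable from u. The indicator of the component of u, shifted to
vanish at node 0, is in the left kernel; it is nonzero since the indicator
differs at u and v and so is not constant. *)
Lemma det_reduced_disconnected (g : 'I_n -> 'I_m) :
  ~ connected_by G [set g k | k in 'I_n] -> \det (colsub g B) = 0.
Proof.
move=> ncT; apply/eqP; apply: contra_notT ncT => /det0P d0 u v.
set T := [set g k | k in 'I_n].
apply: contrapT => /negP uv; apply: d0.
exists (component R G T u *m E); last first.
  rewrite -mulmxA mulmx_colsub ground_reduced mulmx_colsub.
  by apply/rowP=> k; rewrite mxE component_incidence ?mxE // imset_f.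
apply: contra uv => /eqP/rowP x0.
have const i: component R G T u 0 i = component R G T u 0 ord0.
  case: (unliftP ord0 i) => [k|] -> //.
  by have := x0 k; rewrite mul_row_ground [RHS]mxE => /subr0_eq.
have /eqP := etrans (const v) (esym (const u)).
by rewrite !mxE connect0; case: connect; rewrite // eq_sym oner_eq0.
Qed.

Lemma det_reduced_cyclic (g : 'I_n -> 'I_m) :
  injective g -> ~ acyclic G [set g k | k in 'I_n] -> \det (colsub g B) = 0.
Proof.
move=> g_inj /existsNP[c /contrapT/(cycle_dependency R)[y y0 [Ay yT]]].
have ysupp i j : i \notin codom g -> y i j = 0.
  rewrite ord1 => gi; apply: yT; apply: contra gi => /imsetP[k _ ->].
  exact: codom_f.
rewrite -det_tr; apply/eqP/det0P; exists (rowsub g y)^T.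
  apply: contra y0 => /eqP/rowP y0; apply/eqP/colP=> j; rewrite mxE.
  have [/codomP[k ->]|/ysupp-> //] := boolP (j \in codom g).
  by have := y0 k; rewrite !mxE.
rewrite -trmx_mul (mulmx_sub_support _ g_inj ysupp).
by rewrite /B row'Esub mul_rowsub_mx Ay; apply/rowP=> i; rewrite !mxE.
Qed.

Lemma det_mask_reduced T : #|T| = n ->
  \det (B *m mask_mx R T *m B^T) = (`[< spanning_tree G T >])%:R.
Proof.
move=> cT; have [g0 g0_inj DT0] := set_enum T.
have [g g_inj ->]: exists2 g : 'I_n -> 'I_m,
    injective g & T = [set g k | k in 'I_n].
  by case: _ / cT; exists g0.
rewrite mulmx_mask //.
have ->: rowsub g B^T = (colsub g B)^T by apply/matrixP=> i j; rewrite !mxE.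
rewrite det_mulmx det_tr -expr2; case: asboolP => [[conT _]|ntree].
  exact: sqr_det_reduced_connected.
have [conT|ncT] := pselect (connected_by G [set g k | k in 'I_n]); last first.
  by rewrite det_reduced_disconnected // expr0n.
rewrite det_reduced_cyclic ?expr0n // => acT; exact: ntree.
Qed.

(** Only sets of n edges appear in the Cauchy-Binet expansion, and each spanning
tree is such a set. *)
Theorem weighted_matrix_tree w :
  \det (B *m weight_mx w *m B^T) =
  \sum_(T | `[< spanning_tree G T >]) tree_weight w T.
Proof.
rewrite Cauchy_Binet.
rewrite (eq_bigr (fun T => if `[< spanning_tree G T >] then tree_weight w T
                           else 0)).
  rewrite -big_mkcondr; apply: eq_bigl => T /=; apply: andb_idl.
  by move=> /asboolP/card_spanning_tree/eqP.
move=> T /eqP/det_mask_reduced->; rewrite mulr_natr.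
by case: asbool => //; apply: eq_bigr => j _; rewrite mxE.
Qed.

(** * The equilibrium set *)

Lemma ground_mx_inj (z : 'cV[R]_n) : E *m z = 0 -> z = 0.
Proof.
move=> /colP Ez0; apply/colP=> k; have := Ez0 (lift ord0 k).
rewrite mxE [RHS]mxE => Ez.
rewrite [RHS]mxE -Ez (bigD1 k) //= !mxE eqxx subr0 mul1r big1 ?addr0 // => l lk.
by rewrite !mxE (inj_eq lift_inj) (negPf lk) subr0 mul0r.
Qed.

Lemma mem_equilibrium_set_reduced w (x : 'cV[R]_n.+1) :
  (x \in equilibrium_set G w) = (B *m weight_mx w *m B^T *m (E^T *m x) == 0).
Proof.
rewrite mem_equilibrium_set_ker.
have ->: A *m weight_mx w *m A^T *m x =
         E *m (B *m weight_mx w *m B^T *m (E^T *m x)).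
  by rewrite -ground_reduced trmx_mul !mulmxA.
by apply/eqP/eqP=> [/ground_mx_inj|->]; rewrite ?mulmx0.
Qed.

Lemma ground_tr_mul (x : 'cV[R]_n.+1) k :
  (E^T *m x) k 0 = x (lift ord0 k) 0 - x ord0 0.
Proof.
have := mul_row_ground x^T k; rewrite -[x^T *m E]trmxK trmx_mul trmxK.
by rewrite !mxE.
Qed.

(** The line of the constant vectors is the kernel of E^T, so an equilibrium off
this line is a vector x with E^T x a nonzero element of the kernel of L. Any
element z of that kernel arises so, from the x that vanishes at node 0 and
agrees with z elsewhere. *)
Lemma dim_equilibrium_set w :
  (1 < \dim (equilibrium_set G w))%N <-> \det (B *m weight_mx w *m B^T) = 0.
Proof.
set L := B *m _ *m _; set K := equilibrium_set G w.
pose one : 'cV[R]_n.+1 := const_mx 1.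
have E1: E^T *m one = 0.
  by apply/colP=> k; rewrite ground_tr_mul !mxE subrr.
have Kone: (<[one]> <= K)%VS.
  by rewrite -memvE mem_equilibrium_set_reduced E1 mulmx0.
have line x: (x \in <[one]>%VS) = (E^T *m x == 0).
  apply/vlineP/eqP=> [[a ->]|/colP Ex0]; first by rewrite -scalemxAr E1 scaler0.
  exists (x ord0 0); apply/colP=> i; rewrite !mxE mulr1.
  case: (unliftP ord0 i) => [k|] -> //.
  by have /eqP := Ex0 k; rewrite ground_tr_mul mxE subr_eq0 => /eqP.
have dim_one: \dim <[one]> = 1%N.
  rewrite dim_vline; case: eqP => // /colP/(_ ord0)/eqP.
  by rewrite !mxE oner_eq0.
have LT: L^T = L by rewrite !trmx_mul trmxK tr_diag_mx mulmxA.
have ->: (1 < \dim K)%N = ~~ (K <= <[one]>)%VS.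
  rewrite ltnNge; congr negb; apply/idP/idP=> [dK|/dimvS]; rewrite ?dim_one //.
  by have /eqP <-: <[one]>%VS == K by rewrite eqEdim Kone dim_one.
split=> [/subvPn[x]|/eqP/det0P[z z0 zL]].
  rewrite mem_equilibrium_set_reduced line => /eqP Lx Ex.
  apply/eqP/det0P; exists (E^T *m x)^T; first by rewrite trmx_eq0.
  by rewrite -LT -trmx_mul Lx trmx0.
apply/subvPn; pose x : 'cV[R]_n.+1 :=
  \col_i (if unlift ord0 i is Some k then z 0 k else 0).
have Ex: E^T *m x = z^T.
  by apply/colP=> k; rewrite ground_tr_mul !mxE liftK unlift_none subr0.
exists x; last by rewrite line Ex trmx_eq0.
by rewrite mem_equilibrium_set_reduced Ex -/L -LT -trmx_mul zL trmx0.
Qed.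

End Reduced.

(** * Counting signed trees *)

Lemma tree_weight_pm1 (R : realType) (m : nat) (w : 'I_m -> R) T :
  (forall j, w j = -1 \/ w j = 1) -> tree_weight w T = 1 \/ tree_weight w T = -1.
Proof.
move=> hw; apply: (big_ind (fun a : R => a = 1 \/ a = -1)); first by left.
  by move=> _ _ [->|->] [->|->]; rewrite !(mul1r, mulrNN, mulr1);
    [left | right | right | left].
by move=> j _; case: (hw j); [right|left].
Qed.

Lemma sum_tree_weight (R : realType) (n m : nat) (G : digraph n m)
    (w : 'I_m -> R) : (forall j, w j = -1 \/ w j = 1) ->
  \sum_(T | `[< spanning_tree G T >]) tree_weight w T =
  #|positive_spanning_trees G w|%:R - #|negative_spanning_trees G w|%:R.
Proof.
move=> hw; have one_neq_N1: (1 : R) <> -1.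
  by move/eqP; rewrite -addr_eq0 -mulr2n pnatr_eq0.
rewrite -!sum1_card !natr_sum -sumrN.
rewrite (bigID (fun T => tree_weight w T == 1)) /=; congr (_ + _).
  apply: eq_big => T; last by case/andP=> _ /eqP.
  by rewrite inE; apply/andP/asboolP=> [[/asboolP ? /eqP]|[/asboolP ? /eqP]].
apply: eq_big => T.
  rewrite inE; apply/andP/asboolP=> [[/asboolP tT w1]|[/asboolP tT wN]].
    by split=> //; case: (tree_weight_pm1 T hw) w1 => // ->; rewrite eqxx.
  by split=> //; apply/eqP; rewrite wN => /esym.
by case/andP=> _ w1; case: (tree_weight_pm1 T hw) w1 => // ->; rewrite eqxx.
Qed.

Theorem corollary1 (R : realType) (n m : nat) (G : digraph n m)
    (w : 'I_m -> R) (hG : connected G)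
    (hw : forall j, w j = -1 \/ w j = 1) :
  (1 < \dim (equilibrium_set G w))%N <->
  #|positive_spanning_trees G w| = #|negative_spanning_trees G w|.
Proof.
case: n G hG => [|n] G hG; last first.
  rewrite dim_equilibrium_set weighted_matrix_tree (sum_tree_weight G hw).
  split=> [/eqP|->]; last by rewrite subrr.
  by rewrite subr_eq0 eqr_nat => /eqP.
(* Without nodes there are no edges, and the empty set is a positive spanning
   tree while the equilibrium set has dimension zero. *)
have no_edge (j : 'I_m) : False by case: (tail G j).
have tw T : tree_weight w T = 1 by apply: big1 => j; case: (no_edge j).
have sT T : spanning_tree G T by split=> [[]//|[[]|[[]//]]].
have ->: \dim (equilibrium_set G w) = 0%N.
  apply/eqP; rewrite dimv_eq0 -subv0; apply/subvP=> x _.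
  by rewrite memv0; apply/eqP/colP=> -[].
split=> // card_eq.
have: set0 \in positive_spanning_trees G w by rewrite inE; apply/asboolP.
suff /cards0_eq->: #|positive_spanning_trees G w| = 0%N by rewrite inE.
rewrite card_eq; apply/eqP; rewrite cards_eq0; apply/eqP/setP=> T.
rewrite !inE; apply/asboolP=> -[_ /eqP].
by rewrite tw -addr_eq0 -mulr2n pnatr_eq0.
Qed.
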